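(* Let $p>10$ be a prime and let $\#N_p(4)$ be the number of quadratic non-residues modulo $p$ among the integers in $(p/8,p/4)\cup(3p/8,p/2)$. Then $$(-1)^{\#N_p(4)}=\begin{cases}1 & p=1+8k,\\ -1 & p=5+8k,\\ (-1)^k & p=3+8k,\\ (-1)^{k+1} & p=7+8k,\end{cases}$$ where $k\in\mathbb Z_{\ge0}$. *)

(* Defs.v *)
From mathcomp Require Import all_boot all_order all_algebra.

Set Implicit Arguments.
Unset Strict Implicit.
Unset Printing Implicit Defensive.

Import Order.TTheory GRing.Theory Num.Theory.
Local Open Scope ring_scope.

(* a is coprime to m and not a square modulo m; for m > 0 the squares modulo m
   are those of the representatives x < m. *)
Definition quad_nonresidue (m a : nat) : bool :=
  coprime a m && ~~ [exists x : 'I_m, (x ^ 2 == a %[mod m])%N].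

(* The ambient type 'I_p loses nothing: both intervals lie in (0, p). *)
Definition nonresidues4 (p : nat) : {set 'I_p} :=
  [set a : 'I_p |
     ((a%:Q \in `]p%:Q / 8%:Q, p%:Q / 4%:Q[)
      || (a%:Q \in `]3%:Q * p%:Q / 8%:Q, p%:Q / 2%:Q[))
     && quad_nonresidue p a].

(* Main.v *)
(* Write h = (p-1)/2 and work in F_p. Sorting 1, ..., m by parity, the evens are
   2i and the odds are p - 2i = -2i, so
     m! (h - u)! = 2^(m/2) (-2)^u (m/2)! h!   with u = ceil(m/2).
   For m = h this evaluates 2^h; for m = floor(p/4) it says that the product of
   the integers in (p/8, p/4) is 2^(m/2) (-2)^u times the product of those in
   (3p/8, p/2). Raising to the power h (Euler's criterion) turns the product over
   both intervals into the sign (-1)^#N_p(4). *)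

Require Import Defs.
From mathcomp Require Import all_boot all_order all_algebra.
From mathcomp Require Import finfield zify ring.

Set Implicit Arguments.
Unset Strict Implicit.

Import Order.TTheory GRing.Theory Num.Theory.
Local Open Scope ring_scope.

Lemma Fp_natr_eq (p m n : nat) : prime p ->
  (m%:R == n%:R :> 'F_p) = (m == n %[mod p]).
Proof.
move=> pr_p; have cp := pchar_Fp pr_p.
wlog le_nm : m n / (n <= m)%N => [IH|].
  by case/orP: (leq_total n m) => /IH; last rewrite eq_sym [RHS]eq_sym.
by rewrite eqn_mod_dvd // (dvdn_pcharf cp) natrB // subr_eq0.
Qed.

Lemma Fp_nat_neq0 (p m : nat) : prime p -> (0 < m < p)%N -> m%:R != 0 :> 'F_p.
Proof.
move=> pr_p /andP[m0 mp].
by rewrite -(dvdn_pcharf (pchar_Fp pr_p)) gtnNdvd.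
Qed.

Lemma Fp_fact_neq0 (p m : nat) : prime p -> (m < p)%N -> m`!%:R != 0 :> 'F_p.
Proof.
move=> pr_p; elim: m => [|m IHm] mp; first by rewrite fact0 oner_neq0.
by rewrite factS natrM mulf_neq0 //; [apply: Fp_nat_neq0|apply: IHm; apply: ltnW].
Qed.

Lemma prod_nat_fact (R : comNzRingType) (m n : nat) : (m <= n)%N ->
  (\prod_(m.+1 <= i < n.+1) i%:R) * m`!%:R = n`!%:R :> R.
Proof.
move=> mn; rewrite !fact_prod !natr_prod mulrC.
by rewrite (@big_cat_nat _ _ _ m.+1 1 n.+1).
Qed.

Section OddPrime.

Variables (p : nat) (pr_p : prime p) (p_odd : odd p).
Let h := p./2.

Lemma odd_p_eq : p = (h.*2).+1.
Proof. by rewrite -[LHS]odd_double_half p_odd. Qed.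

Lemma Fp_exp_double_half (x : 'F_p) : x != 0 -> x ^+ h.*2 = 1.
Proof.
move=> x0; apply: (mulfI x0); rewrite -exprS mulr1.
by rewrite (_ : h.*2.+1 = #|{: 'F_p}|) ?expf_card // card_Fp // -odd_p_eq.
Qed.

(** Euler's criterion. By Fermat [x ^+ h] squares to 1, so it is 1 or -1; a non-square with value 1
    would give ['X^h - 1] more than [h] roots. *)
Lemma Fp_half_expP (x : 'F_p) :
  x != 0 -> x ^+ h = if [exists y : 'F_p, x == y ^+ 2] then 1 else -1.
Proof.
move=> x0; have xp : x ^+ h * x ^+ h = 1.
  by rewrite -exprD addnn Fp_exp_double_half.
case: existsP => [[y /eqP xy]|nsq].
  rewrite xy -exprM mul2n Fp_exp_double_half //.
  by apply: contraNneq x0 => y0; rewrite xy y0 expr0n.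
have /eqP := xp; rewrite -expr2 sqrf_eq1 => /orP[/eqP x1|/eqP //].
(* The squares of 1, ..., h already exhaust the roots of X^h - 1. *)
pose s := [seq i%:R ^+ 2 | i <- iota 1 h] : seq 'F_p.
have h0 : (0 < h)%N by have := prime_gt1 pr_p; have := odd_p_eq; lia.
have /max_poly_roots : 'X^h - 1 != 0 :> {poly 'F_p}.
  by rewrite -size_poly_eq0 size_XnsubC.
move=> /(_ (x :: s)); rewrite size_XnsubC //= size_map size_iota ltnn.
move=> no_roots.
exfalso; apply: notF; apply: no_roots.
- rewrite rootE !hornerE x1 subrr eqxx /=.
  apply/allP => _ /mapP[i hi ->]; rewrite mem_iota in hi.
  rewrite rootE !hornerE -exprM mul2n.
  have i0 : i%:R != 0 :> 'F_p by apply: Fp_nat_neq0 => //; have := odd_p_eq; lia.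
  by rewrite Fp_exp_double_half ?subrr.
- apply/andP; split.
    by apply/mapP => -[i _ xi]; apply: nsq; exists i%:R; apply/eqP.
  (* Equal squares force i = j or i + j = 0 in F_p, and the latter fails because 0 < i + j < p. *)
  rewrite map_inj_in_uniq ?iota_uniq // => i j.
  rewrite !mem_iota => hi hj /eqP; rewrite eqf_sqr => /orP[].
    by rewrite Fp_natr_eq // !modn_small; have := odd_p_eq; lia.
  rewrite -addr_eq0 -natrD => /negPn/negP[]; apply: Fp_nat_neq0 => //.
  by have := odd_p_eq; lia.
Qed.

Lemma quad_nonresidue_sign (a : nat) : (0 < a < p)%N ->
  (-1) ^+ quad_nonresidue p a = (a%:R : 'F_p) ^+ h.
Proof.
move=> ha; rewrite Fp_half_expP ?Fp_nat_neq0 // /quad_nonresidue.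
have -> : coprime a p.
  by rewrite coprime_sym prime_coprime // gtnNdvd //; case/andP: ha.
have -> : [exists y : 'F_p, a%:R == y ^+ 2] =
          [exists x : 'I_p, (x ^ 2 == a %[mod p])%N].
  apply/existsP/existsP => -[y].
    (* ['F_p] is an ordinal type whose bound is only provably equal to [p], so [y] has to be rebuilt
       in ['I_p]. *)
    have yp : (y < p)%N by rewrite -[X in (_ < X)%N](Fp_cast pr_p).
    move=> ay; exists (Ordinal yp) => /=.
    by rewrite -Fp_natr_eq // natrX natr_Zp eq_sym.
  by rewrite -Fp_natr_eq // natrX eq_sym => ay; exists (y : nat)%:R.
by case: [exists _, _].
Qed.

(* The odd numbers in 1, ..., m are the p - 2i with h - uphalf m < i <= h. *)
Lemma Fp_fact_double (m : nat) : (m <= h.*2)%N ->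
  m`!%:R * (h - uphalf m)`!%:R =
  2 ^+ m./2 * (- 2) ^+ uphalf m * (m./2)`!%:R * h`!%:R :> 'F_p.
Proof.
elim: m => [|m IHm] hm; first by rewrite /= subn0 !expr0 fact0; ring.
have {}IHm := IHm (ltnW hm).
have := odd_double_half m; rewrite /= !uphalf_half in IHm *.
case om: (odd m) IHm => /=; rewrite !(add0n, add1n) => IHm em.
  rewrite !factS exprS !natrM -mulrA IHm -[in m.+1]em.
  have -> : (m./2.*2).+2%:R = 2 * m./2.+1%:R :> 'F_p.
    by rewrite -doubleS -mul2n natrM.
  by ring.
(* Now m is even: the new factor m + 1 = p - 2(h - m/2) is -2 times the top factor h - m/2 that the
   second factorial loses. *)
have dlt : (m./2 < h)%N by lia.
have : (h - m./2)`!%:R = (h - m./2)%:R * (h - m./2.+1)`!%:R :> 'F_p.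
  by rewrite -natrM -subSS subSn // factS.
have modp : m.+1%:R = - 2 * (h - m./2)%:R :> 'F_p.
  apply/eqP; rewrite mulNr -addr_eq0 -natrM -natrD.
  have -> : (m.+1 + 2 * (h - m./2) = p)%N by have := odd_p_eq; lia.
  by rewrite pchar_Fp_0.
move=> e; rewrite e in IHm.
rewrite factS natrM modp exprS.
transitivity (- 2 * (m`!%:R * ((h - m./2)%:R * (h - m./2.+1)`!%:R)) : 'F_p).
  by ring.
by rewrite IHm; ring.
Qed.

(** Take m = h in [Fp_fact_double]: since h - [uphalf h] = [h./2], the same two factorials stand on
    both sides and cancel. *)
Lemma Fp_half_exp2 : 2 ^+ h = (-1) ^+ uphalf h :> 'F_p.
Proof.
have hp : (h < p)%N by have := odd_p_eq; lia.
have := @Fp_fact_double h; rewrite -addnn leq_addr => /(_ isT).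
have -> : (h - uphalf h = h./2)%N by lia.
have n1 := Fp_fact_neq0 pr_p hp.
have n2 : (h./2)`!%:R != 0 :> 'F_p by apply: Fp_fact_neq0 => //; lia.
rewrite [(- 2) ^+ _]exprNn mulrCA -exprD.
have -> : (h./2 + uphalf h = h)%N by lia.
rewrite -[LHS]mul1r mulrC -!mulrA => e.
have /(mulIf (mulf_neq0 n1 n2)) : 1 * (h`!%:R * (h./2)`!%:R) =
  (-1) ^+ uphalf h * 2 ^+ h * (h`!%:R * (h./2)`!%:R) :> 'F_p.
  by rewrite mul1r -[LHS]mulr1 -mulrA e; ring.
by move=> e1; rewrite -[LHS](signrMK (uphalf h)) -e1 mulr1.
Qed.

(** As p = 2h + 1 is odd, no endpoint is an integer; the floors of p/8, p/4, 3p/8, p/2 are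
    [h./2./2], [h./2], [h - uphalf h./2], [h]. *)
Lemma nonresidues4E (a : 'I_p) :
  (a \in nonresidues4 p) =
  ((h./2./2 < a <= h./2)%N || (h - uphalf h./2 < a <= h)%N)
    && quad_nonresidue p a.
Proof.
rewrite inE; congr (_ && _); have pE := odd_p_eq.
rewrite !in_itv /= ltr_pdivrMr // ltr_pdivlMr // ltr_pdivrMr // ltr_pdivlMr //.
rewrite -!intrM !ltr_int.
by lia.
Qed.

Lemma prod_nonresidues4_range (R : comNzRingType) (F : nat -> R) :
  \prod_(a < p | (h./2./2 < a <= h./2)%N || (h - uphalf h./2 < a <= h)%N) F a =
  (\prod_(h./2./2.+1 <= i < h./2.+1) F i) *
  (\prod_((h - uphalf h./2).+1 <= i < h.+1) F i).
Proof.
have pE := odd_p_eq.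
rewrite !(@big_nat_widen _ _ _ _ _ p xpredT); [|lia|lia].
(* The two ranges are disjoint, since [h./2] is at most [h - uphalf h./2]. *)
rewrite !big_geq_mkord (bigID (fun a : 'I_p => a <= h./2)%N) /=.
by congr (_ * _); apply: eq_bigl => a; lia.
Qed.

(** The first summand of the exponent comes from (2^h)^(h/2) through [Fp_half_exp2], the second from
    the sign in (-2)^u raised to the power h. *)
Lemma card_nonresidues4_sign :
  (-1) ^+ #|nonresidues4 p| =
  (-1) ^+ (uphalf h * h./2 + h * uphalf h./2) :> 'F_p.
Proof.
have pE := odd_p_eq.
pose S (a : 'I_p) := (h./2./2 < a <= h./2)%N || (h - uphalf h./2 < a <= h)%N.
have -> : (-1) ^+ #|nonresidues4 p| = (\prod_(a < p | S a) a%:R) ^+ h :> 'F_p.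
  rewrite -prodr_const (eq_bigl _ _ nonresidues4E) big_mkcondr -prodrXl.
  apply: eq_bigr => a Sa; rewrite -quad_nonresidue_sign.
    by case: quad_nonresidue.
  by rewrite ltn_ord andbT; move: Sa; rewrite /S; lia.
rewrite (prod_nonresidues4_range (fun a => a%:R)).
set B := \prod_(_ <= i < h./2.+1) _; set D := \prod_(_ <= i < h.+1) _.
have n1 : (h./2./2)`!%:R != 0 :> 'F_p by apply: Fp_fact_neq0 => //; lia.
have n2 : (h - uphalf h./2)`!%:R != 0 :> 'F_p.
  by apply: Fp_fact_neq0 => //; lia.
have D0 : D != 0.
  have : h`!%:R != 0 :> 'F_p by apply: Fp_fact_neq0 => //; lia.
  by rewrite -(@prod_nat_fact _ (h - uphalf h./2)) ?leq_subr // mulf_eq0 negb_or;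
     case/andP.
(* This is [Fp_fact_double] at m = [h./2], with B and D as quotients of factorials. *)
have BE : B = 2 ^+ h./2./2 * (- 2) ^+ uphalf h./2 * D.
  apply: (mulIf n1); apply: (mulIf n2).
  rewrite prod_nat_fact; last by lia.
  rewrite Fp_fact_double; last by lia.
  rewrite -(@prod_nat_fact _ (h - uphalf h./2) h) ?leq_subr // -/D.
  by ring.
(* The product is now a power of 2 times D^2, and D^2 disappears in the power h. *)
rewrite BE -[_ * D * D]mulrA -(expr2 D) exprMn -exprM mul2n.
rewrite (Fp_exp_double_half D0) mulr1.
rewrite [(- 2) ^+ _]exprNn mulrCA -exprD.
have -> : (h./2./2 + uphalf h./2 = h./2)%N by lia.
rewrite exprMn [(2 ^+ _) ^+ _]exprAC Fp_half_exp2 -!exprM -exprD.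
by rewrite addnC [X in (_ + X)%N]mulnC.
Qed.

End OddPrime.

(** Since 1 and -1 differ in F_p for odd p, a sign computed there determines a parity and so carries
    over to the integers. *)
Lemma Fp_sign_inj (p m n : nat) : prime p -> odd p ->
  (-1) ^+ m = (-1) ^+ n :> 'F_p -> odd m = odd n.
Proof.
move=> pr_p p_odd; rewrite -[LHS]signr_odd -[RHS]signr_odd.
have n2 : 2%:R != 0 :> 'F_p.
  apply: Fp_nat_neq0 => //; have := prime_gt1 pr_p.
  by case: (p) p_odd => [|[|[]]].
case: (odd m) (odd n) => [] [] //= /eqP; rewrite expr0 expr1.
  by rewrite eq_sym -addr_eq0 -[1 + 1]/(2%:R) (negPf n2).
by rewrite -addr_eq0 -[1 + 1]/(2%:R) (negPf n2).
Qed.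

Unset Implicit Arguments.
Set Strict Implicit.

Theorem theorem4p3 (p : nat) (p_prime : prime p) (p_gt10 : (10 < p)%N)
    (k : nat) :
  [/\ p = (1 + 8 * k)%N -> (-1) ^+ #|nonresidues4 p| = 1 :> int,
      p = (5 + 8 * k)%N -> (-1) ^+ #|nonresidues4 p| = -1 :> int,
      p = (3 + 8 * k)%N -> (-1) ^+ #|nonresidues4 p| = (-1) ^+ k :> int
    & p = (7 + 8 * k)%N -> (-1) ^+ #|nonresidues4 p| = (-1) ^+ k.+1 :> int].
Proof.
have p_odd : odd p by case: (even_prime p_prime) => // p2; rewrite p2 in p_gt10.
have := Fp_sign_inj p_prime p_odd (card_nonresidues4_sign p_prime p_odd).
set N := #|_|; rewrite -[(-1) ^+ N]signr_odd => ->.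
(* Only the parity of the exponent remains. In the order of the cases it is that of 0, 1, k and k +
   1. *)
split=> pE.
- have -> : (p./2 = 4 * k)%N by lia.
  have -> : (uphalf (4 * k) = 2 * k)%N by lia.
  have -> : ((4 * k)./2 = 2 * k)%N by lia.
  by rewrite oddD !oddM.
- have -> : (p./2 = 4 * k + 2)%N by lia.
  have -> : (uphalf (4 * k + 2) = 2 * k + 1)%N by lia.
  have -> : ((4 * k + 2)./2 = 2 * k + 1)%N by lia.
  by rewrite !(oddD, oddM).
- have -> : (p./2 = 4 * k + 1)%N by lia.
  have -> : (uphalf (4 * k + 1) = 2 * k + 1)%N by lia.
  have -> : ((4 * k + 1)./2 = 2 * k)%N by lia.
  have -> : (uphalf (2 * k) = k)%N by lia.
  by rewrite !(oddD, oddM) /= signr_odd.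
- have -> : (p./2 = 4 * k + 3)%N by lia.
  have -> : (uphalf (4 * k + 3) = 2 * k + 2)%N by lia.
  have -> : ((4 * k + 3)./2 = 2 * k + 1)%N by lia.
  have -> : (uphalf (2 * k + 1) = k.+1)%N by lia.
  by rewrite !(oddD, oddM) signr_odd.
Qed.
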